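(* Let $k$ be a field of characteristic zero, $P_n=k[x_1,\ldots,x_n]$, and let $\mathscr{L}_n$ be the left-symmetric algebra of all derivations of $P_n$. Let $D\in\mathscr{L}_n$. Then the Jacobian matrix $J(D)$ is nilpotent if and only if $\mathrm{div}(D^{[q]})=0$ for all $q\geq 1$.
   Context: Write $\partial_i=\partial/\partial x_i$. For an $n$-tuple $F=(f_1,\ldots,f_n)$ of elements of $P_n$ put $D_F=f_1\partial_1+\cdots+f_n\partial_n$; every $k$-linear derivation $D$ of $P_n$ equals $D_F$ for a unique $F$. $\mathscr{L}_n$ is the vector space of all $k$-linear derivations of $P_n$ with the bilinear product determined by $(a\partial_i)\cdot(b\partial_j)=\big(a\,\partial_i(b)\big)\partial_j$ for $a,b\in P_n$; equivalently $D\cdot D_G=D_{D(G)}$, where $D(G)=(D(g_1),\ldots,D(g_n))$ for $G=(g_1,\ldots,g_n)$. The Jacobian matrix of $D=D_F$ is $J(D)=J(F)=(\partial_j(f_i))_{1\le i,j\le n}\in M_n(P_n)$, and the divergence is $\mathrm{div}(D)=\sum_{i=1}^n\partial_i(f_i)=\mathrm{Tr}(J(D))$. The right powers of $D$ are $D^{[1]}=D$ and $D^{[r+1]}=D^{[r]}\cdot D$ for $r\ge 1$. *)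

(* Defs.v *)
From HB Require Import structures.
From mathcomp Require Import all_boot all_algebra.
From mathcomp.multinomials Require Import mpoly.

Set Implicit Arguments.
Unset Strict Implicit.
Unset Printing Implicit Defensive.

Import GRing.Theory.
Local Open Scope ring_scope.

Section Derivations.
Variables (k : fieldType) (n : nat).
Local Notation P := {mpoly k[n]}.

Record derivation : Type := Derivation {
  der_fun :> {linear P -> P};
  der_leibniz : forall p q : P, der_fun (p * q) = der_fun p * q + p * der_fun q
}.

Definition der_of_fun (F : 'I_n -> P) (p : P) : P :=
  \sum_(i < n) F i * p^`M(i).

Lemma der_of_is_linear F : linear (der_of_fun F).
Proof.
move=> c p q; rewrite /der_of_fun scaler_sumr -big_split /=.
by apply: eq_bigr => i _; rewrite mderivD mderivZ mulrDr scalerAr.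
Qed.

HB.instance Definition _ F :=
  GRing.isLinear.Build k P P _ (der_of_fun F) (der_of_is_linear F).

Lemma der_of_leibniz F (p q : P) :
  der_of_fun F (p * q) = der_of_fun F p * q + p * der_of_fun F q.
Proof.
rewrite /der_of_fun mulr_suml mulr_sumr -big_split /=.
apply: eq_bigr => i _.
by rewrite mderivM mulrDr (mulrCA p) !mulrA.
Qed.

(* The derivation [D_F = \sum_i f_i * d/dx_i]. *)
Definition der_of (F : 'I_n -> P) : derivation :=
  @Derivation (der_of_fun F) (der_of_leibniz F).

(* The unique tuple [F] with [D = D_F]; see [derE] and [der_coef_of]. *)
Definition der_coef (D : derivation) (i : 'I_n) : P := D 'X_i.

(* The left-symmetric product, [D . D_G = D_{D(G)}]. *)
Definition lsmul (D E : derivation) : derivation :=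
  der_of (fun i => D (der_coef E i)).

(* [rpow D q] is the right power [D^[q]] for [0 < q]: [D^[1] = D] and
   [D^[r+1] = D^[r] . D].  The value at [q = 0] is meaningless. *)
Definition rpow (D : derivation) (q : nat) : derivation :=
  iter q.-1 (fun E => lsmul E D) D.

Definition jacobian (D : derivation) : 'M[P]_n :=
  \matrix_(i < n, j < n) (der_coef D i)^`M(j).

Definition divergence (D : derivation) : P :=
  \sum_(i < n) (der_coef D i)^`M(i).

Lemma der_coef_of F : der_coef (der_of F) =1 F.
Proof.
move=> i; rewrite /der_coef /= /der_of_fun (bigD1 i) //= big1 => [|j ne_ji].
  have subUU : (U_(i) - U_(i) = 0)%MM by apply/mnmP=> j; rewrite mnmBE mnm0E subnn.
  by rewrite mderivX mnm1E eqxx scale1r subUU mpolyX0 mulr1 addr0.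
by rewrite mderivX mnm1E eq_sym (negPf ne_ji) scale0r mulr0.
Qed.

Lemma der1 (D : derivation) : D 1 = 0.
Proof.
have := der_leibniz D 1 1; rewrite !mulr1 mul1r => /eqP.
by rewrite -subr_eq subrr eq_sym => /eqP.
Qed.

Lemma derE (D : derivation) : D =1 der_of (der_coef D).
Proof.
set E := der_of _.
have eqX i : D 'X_i = E 'X_i by rewrite -[RHS]/(der_coef E i) der_coef_of.
have eqXn i m : D ('X_i ^+ m) = E ('X_i ^+ m).
  elim: m => [|m IHm]; first by rewrite !expr0 !der1.
  by rewrite exprS !der_leibniz IHm eqX.
have eqM m : D 'X_[m] = E 'X_[m].
  rewrite mpolyXE_id; elim/big_ind: _ => [|p q Dp Dq|i _] //.
    by rewrite !der1.
  by rewrite !der_leibniz Dp Dq.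
move=> p; elim/mpolyind: p => [|c m p _ _ IHp]; first by rewrite !linear0.
by rewrite !linearP eqM IHp.
Qed.

Lemma lsmul_of D G : lsmul D (der_of G) =1 der_of (fun i => D (G i)).
Proof. by move=> p; apply: eq_bigr => i _; rewrite der_coef_of. Qed.

Lemma divergenceE D : divergence D = \tr (jacobian D).
Proof. by apply: eq_bigr => i _; rewrite mxE. Qed.

End Derivations.

(* Main.v *)
Require Import Defs.
From mathcomp Require Import all_boot all_algebra.
From mathcomp.multinomials Require Import mpoly.

Import GRing.Theory.
Local Open Scope ring_scope.

(** Write J for the Jacobian matrix of D, and let a derivation E act on matrices
    entrywise.  The argument compares div (D^[q]) with tr (J^q).

    The chain rule gives J(E . D) = E(J) + J J(E) ([jacobian_lsmul]).  Since
    D^[q+1] = D^[q] . D, multiplying by J^p and taking traces gives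
    tr (J^p J(D^[q+1])) = tr (J^p D^[q](J)) + tr (J^(p+1) J(D^[q])),
    and by cyclicity of the trace the first term on the right is
    D^[q](tr J^(p+1)) / (p+1) ([derivation_mxtraceX]).  Unfolding from p = 0,
    div (D^[q]) is tr (J^q) plus a combination of derivatives of the
    traces of lower powers of J.  Hence, if those lower traces vanish,
    div (D^[q]) = tr (J^q) ([mxtrace_jacobian_rpow]).  By induction on q, all
    divergences vanish if and only if all traces tr (J^q), q >= 1, vanish.

    It remains to know that over an integral domain of characteristic zero a
    matrix is nilpotent if and only if all its positive powers have trace zero
    ([nilpotent_mxtraceP]).  Over the field of fractions this follows from rank
    factorizations A = L R, for which tr A = tr (R L): if A is nilpotent then so
    is the smaller matrix R L, with a smaller exponent, and if A is idempotent
    then R L is the identity, so that tr A is the rank of A.  When all the traces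
    vanish, the latter applies to the Fitting idempotent of A: it is a polynomial
    in A without constant term, so it has trace zero, hence rank zero. *)

(** * Traces of powers and nilpotency *)

Lemma pchar0_inj {R S : idomainType} (f : {rmorphism R -> S}) :
  injective f -> [pchar R] =i pred0 -> [pchar S] =i pred0.
Proof.
move=> f_inj /pcharf0P R0; apply/pcharf0P=> m.
by rewrite -(rmorph_nat f) -(rmorph0 f) (inj_eq f_inj) R0.
Qed.

(** With A = L R a rank factorization, tr A = tr (R L), and
    A^(m+1) = L (R L)^m R with L and R cancellable, so that R L is nilpotent with
    exponent one less.  The dimension changes along the induction. *)
Lemma mxtrace_nilpotent_field {F : fieldType} {n : nat} (A : 'M[F]_n) (m : nat) :
  A ^+ m = 0 -> \tr A = 0.
Proof.
elim: m n A => [|m IHm] n A Am0.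
  by rewrite -[A]mulr1 -(expr0 A) Am0 mulr0 mxtrace0.
set L := col_base A; set R := row_base A.
have defA : L *m R = A := mulmx_base A.
rewrite -defA mxtrace_mulC; apply: IHm.
have expLR j : A ^+ j.+1 = L *m (R *m L) ^+ j *m R.
  elim: j => [|j IHj]; first by rewrite expr0 mulmx1.
  by rewrite exprS IHj exprS -[A * _]/(A *m _) -[_ * _ ^+ j]/(_ *m _ ^+ j)
     -{1}defA !mulmxA.
apply: (row_free_inj (row_base_free A)); apply: (row_full_inj (col_base_full A)).
by rewrite /= mul0mx mulmx0 mulmxA -expLR.
Qed.

(** With e = L R a rank factorization, e e = e reads L (R L) R = L R; cancelling
    L and R leaves R L = 1, an identity matrix of size the rank of e. *)
Lemma mxtrace_idempotent {F : fieldType} {n : nat} (e : 'M[F]_n) :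
  e *m e = e -> \tr e = (\rank e)%:R.
Proof.
set L := col_base e; set R := row_base e.
have defe : L *m R = e := mulmx_base e.
move=> ee; have RL1 : R *m L = 1%:M.
  apply: (row_free_inj (row_base_free e)); apply: (row_full_inj (col_base_full e)).
  by rewrite /= mul1mx -[R *m L *m R]mulmxA mulmxA defe.
by rewrite -{1}defe mxtrace_mulC RL1 mxtrace1.
Qed.

Lemma mxtrace_hornerMX {R : comNzRingType} {n : nat} (A : 'M[R]_n.+1) (u : {poly R}) :
  (forall q, \tr (A ^+ q.+1) = 0) -> \tr (horner_mx A (u * 'X)) = 0.
Proof.
move=> trA; rewrite -[u]coefK poly_def mulr_suml !raddf_sum /= big1 // => i _.
rewrite -scalerAl -exprSr linearZ /= rmorphXn /= horner_mx_X.
by rewrite mxtraceZ trA mulr0.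
Qed.

(** Writing the characteristic polynomial as g X^a with g(0) != 0, a Bezout
    relation p + r = 1 with p a multiple of X^(a+1) and r a multiple of g makes
    p(A) the projection onto the part where A is invertible.  Its trace is zero
    as p has no constant term, so in characteristic zero p(A) = 0, and then
    A^(a+1) = A^(a+1) r(A) = 0 by Cayley-Hamilton. *)
Lemma nilpotent_mxtrace0_field {F : fieldType} (char0 : [pchar F] =i pred0)
    {n : nat} (A : 'M[F]_n) :
  (forall q, \tr (A ^+ q.+1) = 0) -> exists m, A ^+ m = 0.
Proof.
case: n A => [|n] A trA; first by exists 0%N; apply: flatmx0.
have [a [g nz_g def_chi]] := multiplicity_XsubC (char_poly A) 0.
rewrite subr0 in def_chi.
have chi_neq0 : char_poly A != 0 by rewrite monic_neq0 ?char_poly_monic.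
rewrite chi_neq0 /= in nz_g.
(* The exponent a.+1 rather than a makes p vanish at 0 even when A is invertible. *)
have /Bezout_coprimepP[[u v] /= /eqpP [[c d] /= /andP[c0 d0] bez]] : coprimep ('X ^+ a.+1) g.
  by rewrite coprimep_expl // coprimep_sym coprimepX.
pose p := (c / d) *: u * 'X ^+ a.+1; pose r := (c / d) *: v * g.
have pr1 : p + r = 1.
  apply: (scalerI d0); rewrite -bez !scalerDr /p /r -!scalerAl !scalerA.
  by rewrite mulrCA divff // mulr1.
have gX w : horner_mx A (w * (g * 'X ^+ a.+1)) = 0.
  by rewrite exprSr [g * _]mulrA -def_chi mulrCA rmorphM /= Cayley_Hamilton mul0r.
set e := horner_mx A p.
have tr0 : \tr e = 0 by rewrite /e /p exprSr mulrA mxtrace_hornerMX.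
have ee : e *m e = e.
  rewrite -[_ *m _]/(e * e) -rmorphM /=.
  have -> : p * p = p - p * r.
    by apply/eqP; rewrite eq_sym subr_eq -mulrDr pr1 mulr1.
  have -> : p * r = (c / d) *: u * ((c / d) *: v) * (g * 'X ^+ a.+1).
    by rewrite /p /r mulrACA [_ * g]mulrC.
  by rewrite rmorphB /= gX subr0.
have e0 : e = 0.
  apply/eqP; rewrite -mxrank_eq0.
  have /pcharf0P <- := char0; by rewrite -mxtrace_idempotent // tr0.
exists a.+1.
have -> : A ^+ a.+1 = horner_mx A ('X ^+ a.+1) by rewrite rmorphXn /= horner_mx_X.
rewrite -['X ^+ _]mulr1 -pr1 mulrDr rmorphD /= rmorphM /= -/e e0 mulr0 add0r.
by rewrite /r mulrCA [_ * g]mulrC gX.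
Qed.

Lemma nilpotent_mxtraceP {R : idomainType} (char0 : [pchar R] =i pred0)
    {n : nat} (A : 'M[R]_n) :
  (exists m, A ^+ m = 0) <-> (forall q, \tr (A ^+ q.+1) = 0).
Proof.
have tofracX (B : 'M[R]_n) m : map_mx (@tofrac R) (B ^+ m) = map_mx (@tofrac R) B ^+ m.
  elim: m => [|m IHm]; first exact: map_mx1.
  by rewrite !exprS -IHm; apply: map_mxM.
have tofrac_inj : injective (@tofrac R) by move=> x y /eqP; rewrite tofrac_eq => /eqP.
split=> [[m Am0] q | trA].
  apply/eqP; rewrite -tofrac_eq0 -trace_map_mx; apply/eqP.
  apply: (@mxtrace_nilpotent_field _ _ _ m).
  by rewrite -tofracX -exprM mulnC exprM Am0 exprS mul0r map_mx0.
have [||m Am0] := @nilpotent_mxtrace0_field {fraction R} _ n (map_mx (@tofrac R) A).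
- exact: pchar0_inj tofrac_inj char0.
- by move=> q; rewrite -tofracX trace_map_mx trA rmorph0.
exists m; apply/matrixP=> i j; apply/eqP; rewrite mxE -tofrac_eq0.
by move/matrixP/(_ i j): Am0; rewrite -tofracX !mxE => ->.
Qed.

(** * Jacobian matrices of right powers *)

(** The j-th partial derivative of E(f_i), the sum of the e_l d_l(f_i): the terms
    where d_j hits d_l(f_i) form E(d_j f_i), as partial derivatives commute. *)
Lemma jacobian_lsmul {k : fieldType} {n : nat} (E D : derivation k n) :
  jacobian (lsmul E D) = map_mx E (jacobian D) + jacobian D *m jacobian E.
Proof.
have EE p : E p = \sum_(l < n) der_coef E l * p^`M(l) by apply: derE.
apply/matrixP=> i j; rewrite !mxE /lsmul der_coef_of 2!EE.
rewrite raddf_sum -big_split /=; apply: eq_bigr => l _.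
by rewrite !mxE mderivM mderiv_comm addrC [X in X + _ = _]mulrC.
Qed.

Lemma map_derivationM {k : fieldType} {n p q r : nat} (E : derivation k n)
    (A : 'M[{mpoly k[n]}]_(p, q)) (B : 'M[{mpoly k[n]}]_(q, r)) :
  map_mx E (A *m B) = map_mx E A *m B + A *m map_mx E B.
Proof.
apply/matrixP=> i j; rewrite !mxE raddf_sum -big_split /=.
by apply: eq_bigr => l _; rewrite der_leibniz !mxE.
Qed.

(** The Leibniz rule expands E(A^(m+1)) into m+1 products with one factor E(A);
    A need not commute with E(A), but cyclicity makes the traces all equal. *)
Lemma derivation_mxtraceX {k : fieldType} {n p : nat} (E : derivation k n)
    (A : 'M[{mpoly k[n]}]_p) (m : nat) :
  E (\tr (A ^+ m.+1)) = \tr (A ^+ m *m map_mx E A) *+ m.+1.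
Proof.
(* The factor A^j is what the induction on l accumulates on the left. *)
have trE j l : \tr (A ^+ j *m map_mx E (A ^+ l.+1))
               = \tr (A ^+ (j + l) *m map_mx E A) *+ l.+1.
  elim: l j => [|l IHl] j; first by rewrite expr1 addn0.
  rewrite exprS map_derivationM mulmxDr mxtraceD mulmxA mxtrace_mulC !mulmxA.
  rewrite -[A ^+ l.+1 *m A ^+ j]/(A ^+ l.+1 * A ^+ j) -exprD.
  rewrite -[A ^+ j *m A]/(A ^+ j * A) -exprSr IHl.
  by rewrite [(j.+1 + l)%N]addSnnS [(l.+1 + j)%N]addnC -mulrS.
rewrite -[m in RHS]add0n -trE expr0 mul1mx.
by rewrite raddf_sum; apply: eq_bigr => i _; rewrite mxE.
Qed.

Lemma pchar0_mpoly {k : fieldType} {n : nat} :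
  [pchar k] =i pred0 -> [pchar {mpoly k[n]}] =i pred0.
Proof.
apply: (@pchar0_inj k {mpoly k[n]} (@mpolyC n k)) => x y xy.
by apply/eqP; rewrite -subr_eq0 -(mpolyC_eq0 n) mpolyCB xy subrr.
Qed.

(** One step of the recursion D^[q+1] = D^[q] . D trades a factor J(D^[q+1]) for
    J J(D^[q]), which is why the power J^p is carried along; the error term is
    the derivative of tr (J^(p+1)) divided by p+1, and this trace is one of those
    assumed to vanish. The case p = 0 computes the divergence of D^[q+1]. *)
Lemma mxtrace_jacobian_rpow {k : fieldType} (char0 : [pchar k] =i pred0) {n : nat}
    (D : derivation k n) (p q : nat) :
  (forall r, (r < p + q)%N -> \tr (jacobian D ^+ r.+1) = 0) ->
  \tr (jacobian D ^+ p *m jacobian (rpow D q.+1)) = \tr (jacobian D ^+ (p + q).+1).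
Proof.
elim: q p => [|q IHq] p trJ; first by rewrite addn0 exprSr.
rewrite [rpow D q.+2]/(lsmul (rpow D q.+1) D) jacobian_lsmul mulmxDr mxtraceD.
set E := rpow D q.+1.
have -> : \tr (jacobian D ^+ p *m map_mx E (jacobian D)) = 0.
  have := derivation_mxtraceX E (jacobian D) p.
  rewrite trJ ?raddf0; last by rewrite addnS ltnS leq_addr.
  move/esym/eqP; rewrite -mulr_natr mulf_eq0 => /orP[/eqP //|].
  by have /pcharf0P -> := @pchar0_mpoly k n char0.
rewrite add0r mulmxA -[_ ^+ p *m jacobian D]/(jacobian D ^+ p * jacobian D) -exprSr.
by rewrite IHq addSnnS.
Qed.

Theorem lemma9 (k : fieldType) (char0 : [pchar k] =i pred0) (n : nat)
    (D : derivation k n) :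
  (exists m : nat, jacobian D ^+ m = 0) <->
  (forall q : nat, (1 <= q)%N -> divergence (rpow D q) = 0).
Proof.
rewrite (nilpotent_mxtraceP (pchar0_mpoly char0)).
have divE q : (forall r, (r < q)%N -> \tr (jacobian D ^+ r.+1) = 0) ->
    divergence (rpow D q.+1) = \tr (jacobian D ^+ q.+1).
  move=> trJ; rewrite -[q in RHS]add0n -mxtrace_jacobian_rpow //.
  by rewrite expr0 mul1mx divergenceE.
split=> [trJ [|q] // _ | divD q]; first by rewrite divE.
by elim/ltn_ind: q => q IHq; rewrite -divE ?divD.
Qed.
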